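(* Let $R$ be a countable ring and let $A$ be an uncountable Polish $R$-module with a Kaplansky decomposition $A=\bigoplus_{i\in I}A_i$. Then there is a partition $I=I_1\,\dot\cup\, I_2$ of the index set with $I_1$ countable such that, writing $$A=\Big(\bigoplus_{i\in I_1}A_i\Big)\oplus\Big(\bigoplus_{i\in I_2}A_i\Big)=B\oplus U,$$ the (uncountable) direct summand $U=\bigoplus_{i\in I_2}A_i$ is $\Sigma$-algebraically compact.
   Context: Rings have an identity $1\neq 0$; modules are unital left modules. A countable ring $R$ carries the discrete topology. A Polish $R$-module is an $R$-module $A$ with a topology that is separable and completely metrizable, for which $(A,+,-,0)$ is a topological group and scalar multiplication $R\times A\to A$ is continuous. A Kaplansky decomposition of $A$ is a direct sum decomposition (purely algebraic, no topological condition on the summands) $A=\bigoplus_{i\in I}A_i$ with every $A_i$ nonzero and countable (finite counts as countable). A positive-primitive (pp) formula $\varphi(u_1,\dots,u_n)$ in the language of $R$-modules is one equivalent, over the axioms of $R$-modules, to an existentially quantified finite system of homogeneous $R$-linear equations; its solution set $\varphi(M)\subseteq M^n$ in a module $M$ is called a pp-definable subgroup. A module $M$ is pure-injective if every pure embedding $M\hookrightarrow N$ splits. A module $M$ is $\Sigma$-algebraically compact if every direct sum of copies of $M$ is pure-injective; equivalently, for every $n$, every descending chain of pp-definable subgroups of $M^n$ stabilizes. *)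

(* Defs.v *)
From HB Require Import structures.
From mathcomp Require Import all_boot all_order all_algebra.
From mathcomp Require Import finmap.
From mathcomp Require Import all_classical all_reals topology.
Set Implicit Arguments.
Unset Strict Implicit.
Unset Printing Implicit Defensive.
Import Order.TTheory GRing.Theory Num.Theory.
Local Open Scope classical_set_scope.
Local Open Scope ring_scope.

Definition separable (T : topologicalType) : Prop :=
  exists2 D : set T, countable D & dense D.

Definition is_metric (K : realType) (T : Type) (d : T -> T -> K) : Prop :=
  [/\ forall x y, 0 <= d x y,
      forall x y, d x y = 0 <-> x = y,
      forall x y, d x y = d y x &
      forall x y z, d x z <= d x y + d y z].

Definition metrizes (K : realType) (T : topologicalType) (d : T -> T -> K) :
    Prop :=
  forall (x : T) (V : set T),
    nbhs x V <-> exists2 e : K, 0 < e & [set y | d x y < e] `<=` V.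

Definition complete_metric (K : realType) (T : topologicalType)
    (d : T -> T -> K) : Prop :=
  forall u : nat -> T,
    (forall e : K, 0 < e -> exists N : nat,
       forall m n : nat, (N <= m)%N -> (N <= n)%N -> d (u m) (u n) < e) ->
    exists l : T, u @ \oo --> l.

Definition completely_metrizable (K : realType) (T : topologicalType) : Prop :=
  exists d : T -> T -> K, [/\ is_metric d, metrizes d & complete_metric d].

(* The real field [K] only serves as the codomain of metrics. *)
Definition polish (K : realType) (T : topologicalType) : Prop :=
  separable T /\ completely_metrizable K T.

(* The library's [topologicalLmodType] requires a [numDomainType] of scalars;
   here the scalars form an arbitrary ring with the discrete topology.  Only
   [topology] is imported above because HB rejects this structure once the
   library's topological modules (file [tvs]) are loaded. *)
HB.mixin Record isTopMod (R : nzRingType) M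
    & Topological M & GRing.Lmodule R M := {
  topmod_add_continuous : continuous (fun x : M * M => x.1 + x.2) ;
  topmod_opp_continuous : continuous (-%R : M -> M) ;
  topmod_scale_continuous :
    continuous (fun x : discrete_topology R * M => (x.1 : R) *: x.2)
}.

#[short(type="topModType")]
HB.structure Definition TopMod (R : nzRingType) :=
  {M of Topological M & GRing.Lmodule R M & isTopMod R M}.

(* Submodules of [M] are the predicates of type [submodClosed M]. *)
Definition submod_type (R : nzRingType) (M : lmodType R)
  (S : submodClosed M) : Type := {x : M | x \in S}.

Section SubmodType.
Variables (R : nzRingType) (M : lmodType R) (S : submodClosed M).
HB.instance Definition _ := [isSub of submod_type S for @sval _ _].
HB.instance Definition _ := [Choice of submod_type S by <:].
HB.instance Definition _ :=
  [SubChoice_isSubLmodule of submod_type S by <:].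
End SubmodType.

Definition finitely_supported (I : Type) (M : zmodType) (a : I -> M) : Prop :=
  finite_set [set i | a i != 0].

Section FinitelySupported.
Variables (I : Type) (R : nzRingType) (M : lmodType R).

Lemma finitely_supported0 : finitely_supported (fun _ : I => 0 : M).
Proof.
rewrite /finitely_supported (_ : [set _ | _] = set0) ?finite_set0 //.
by apply/seteqP; split => i //=; rewrite eqxx.
Qed.

Lemma finitely_supportedP (c : R) (a b : I -> M) :
  finitely_supported a -> finitely_supported b ->
  finitely_supported (fun i => c *: a i + b i).
Proof.
move=> fa fb; apply: (@sub_finite_set _ _
  ([set i | a i != 0] `|` [set i | b i != 0])); last by rewrite finite_setU.
move=> i /=; have [-> |] := eqVneq (a i) 0; last by left.
by rewrite scaler0 add0r; right.
Qed.
End FinitelySupported.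

(* The direct sum of copies of [M] indexed by [J]. *)
Section DirectPower.
Variables (J : Type) (R : nzRingType) (M : lmodType R).

Definition dpower_pred : {pred (J -> M)} :=
  fun a => `[< finitely_supported a >].

Lemma dpower_closed : subsemimod_closed dpower_pred.
Proof.
split; [split|] => [|a b|c a]; rewrite /in_mem /= => *; apply/asboolP.
- exact: finitely_supported0.
- have := @finitely_supportedP J R M 1 a b (asboolW _) (asboolW _).
  by under eq_fun do rewrite scale1r; exact.
- have /(_ (asboolW _)) := @finitely_supportedP J R M c a 0 ^~ (finitely_supported0 _ _).
  by under eq_fun do rewrite addr0; exact.
Qed.

HB.instance Definition _ :=
  GRing.isSubmodClosed.Build R (J -> M) dpower_pred dpower_closed.

Definition dpower : lmodType R := submod_type dpower_pred.
End DirectPower.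

Section FiniteSum.
Variables (R : nzRingType) (M : lmodType R) (I : choiceType).

Lemma finitely_supported_sumP (D : set I) (c : R) (a b : I -> M) :
  finitely_supported a -> finitely_supported b ->
  \sum_(i \in D) (c *: a i + b i) =
  c *: (\sum_(i \in D) a i) + \sum_(i \in D) b i.
Proof.
move=> fa fb; pose S := D `&` ([set i | a i != 0] `|` [set i | b i != 0]).
have fS : finite_set S.
  by apply: finite_setIr; rewrite finite_setU.
have widen (f : I -> M) : (forall i, a i = 0 -> b i = 0 -> f i = 0) ->
    \sum_(i \in D) f i = \sum_(i <- fset_set S) f i.
  move=> f0; rewrite -fsbig_finite//; apply/esym/fsbig_widen.
    by move=> i [].
  move=> i [Di nSi] /=; apply: f0; apply/eqP/negPn/negP => n0; apply: nSi.
    by split => //; left.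
  by split => //; right.
rewrite !widen// ?big_split/= ?scaler_sumr//.
by move=> i -> ->; rewrite scaler0 addr0.
Qed.
End FiniteSum.

Section InternalSum.
Variables (R : nzRingType) (M : lmodType R) (I : choiceType).
Variable (A_ : I -> submodClosed M).

Definition direct_decomposition : Prop :=
  forall x : M, exists! a : I -> M,
    [/\ forall i, a i \in A_ i, finitely_supported a &
        x = \sum_(i \in [set: I]) a i].

Definition kaplansky_decomposition : Prop :=
  direct_decomposition /\
  forall i, (exists2 x : M, x \in A_ i & x != 0) /\
            countable [set x : M | x \in A_ i].

Variable D : set I.

Definition partial_sum : {pred M} := fun x =>
  `[< exists a : I -> M, [/\ forall i, a i \in A_ i, finitely_supported a &
        x = \sum_(i \in D) a i] >].

Lemma partial_sum_closed : subsemimod_closed partial_sum.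
Proof.
suff sumP (c : R) (x y : M) :
    x \in partial_sum -> y \in partial_sum -> c *: x + y \in partial_sum.
  have sum0 : 0 \in partial_sum.
    apply/asboolP; exists (fun=> 0); split; first by move=> i; exact: rpred0.
      exact: finitely_supported0.
    by rewrite fsbig1.
  split; [split=> // x y|move=> c x].
    by move=> px py; rewrite -[x]scale1r sumP.
  by move=> px; rewrite -[_ *: _]addr0 sumP.
move=> /asboolP[a [aA fa ->]] /asboolP[b [bA fb ->]]; apply/asboolP.
exists (fun i => c *: a i + b i); split.
- by move=> i; rewrite rpredD// rpredZ.
- exact: finitely_supportedP.
- by rewrite finitely_supported_sumP.
Qed.

HB.instance Definition _ :=
  GRing.isSubmodClosed.Build R M partial_sum partial_sum_closed.
End InternalSum.

(* [exists v, pp_free *m u + pp_bound *m v = 0]; every pp formula is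
   equivalent to one of this shape. *)
Record pp_formula (R : nzRingType) (n : nat) := PPFormula {
  pp_eqs : nat;
  pp_vars : nat;
  pp_free : 'M[R]_(pp_eqs, n);
  pp_bound : 'M[R]_(pp_eqs, pp_vars)
}.

Definition pp_set (R : nzRingType) (n : nat) (phi : pp_formula R n)
    (M : lmodType R) : set ('I_n -> M) :=
  [set u | exists v : 'I_(pp_vars phi) -> M, forall i,
     \sum_j pp_free phi i j *: u j + \sum_j pp_bound phi i j *: v j = 0].

Definition pure_embedding (R : nzRingType) (M N : lmodType R)
    (f : {linear M -> N}) : Prop :=
  injective f /\
  forall n (phi : pp_formula R n) (u : 'I_n -> M),
    pp_set phi (f \o u) -> pp_set phi u.

Definition pure_injective (R : nzRingType) (M : lmodType R) : Prop :=
  forall (N : lmodType R) (f : {linear M -> N}), pure_embedding f ->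
    exists g : {linear N -> M}, cancel f g.

Definition sigma_algebraically_compact (R : nzRingType) (M : lmodType R) :
    Prop :=
  forall J : Type, pure_injective (dpower J M).

(* Main.v *)
From HB Require Import structures.
Require Import Defs.
From mathcomp Require Import all_boot all_order all_algebra.
From mathcomp Require Import finmap.
From mathcomp Require Import all_classical all_reals topology.
Set Implicit Arguments.
Unset Strict Implicit.
Unset Printing Implicit Defensive.
Import Order.TTheory GRing.Theory Num.Theory.
Local Open Scope classical_set_scope.
Local Open Scope ring_scope.

(** A module whose pp-definable subgroups satisfy the descending chain
    condition is algebraically compact, hence pure-injective, and the condition
    passes to direct powers because a formula is evaluated coordinatewise there.
    So it suffices to find a countable [I1] such that the sum [U] of the other
    summands has the chain condition ([pp_dcc_pure_injective],
    [pp_dcc_dpower]).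

    Since [R] is countable there are only countably many pairs consisting of a
    finite conjunction [Phi] of formulas and a formula [psi].  Call such a pair
    thin when [Phi(A_i)] is contained in [psi(A_i)] for all but countably many
    [i], and let [I1] collect the exceptional indices of all thin pairs; it is
    countable.  Formulas are evaluated coordinatewise in [U] as well, so a thin
    pair satisfies [Phi(U) <= psi(U)] exactly.  What remains is to show that,
    given formulas [E 0, E 1, ...], for some [n] the conjunction of
    [E 0, ..., E n] forms a thin pair with [E n.+1] ([gap_countable]).

    This is where the topology enters.  Suppose that all these pairs fail at
    uncountably many indices.  At stage [k] there are uncountably many elements
    [t_i] of different summands which lie in the first [k + 1] subgroups but not
    in the next one.  By separability two of them, together with witnesses for
    the quantified variables of their formulas, are as close as desired; their
    difference [a_k] is then a small element of the first [k + 1] subgroups,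
    with small witnesses, and one of its coordinates, at an index [i_k] outside
    the supports of the earlier terms, is not in the next subgroup.  By
    completeness the series of the [a_k] converges to some [x], and so do the
    tails of the witnesses; hence [x - (a_0 + ... + a_k)] lies in the subgroup
    of [E k.+1], which forces [x] to have a nonzero coordinate at [i_k].  The
    [i_k] being distinct, [x] has infinite support, a contradiction. *)

(** * Linear systems and the descending chain condition *)

Definition lin (R : nzRingType) (V : Type) (M : lmodType R)
    (t : seq (R * V)) (h : V -> M) : M :=
  \sum_(e <- t) e.1 *: h e.2.

Section Lin.
Variables (R : nzRingType) (V : Type) (M : lmodType R).
Implicit Types (t : seq (R * V)) (h : V -> M).

Lemma lin0 t : lin t (fun=> 0 : M) = 0.
Proof. by rewrite /lin big1 // => e _; rewrite scaler0. Qed.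

Lemma linD t h h' : lin t (fun v => h v + h' v) = lin t h + lin t h'.
Proof. by rewrite /lin -big_split; apply: eq_bigr => e _; rewrite scalerDr. Qed.

Lemma linB t h h' : lin t (fun v => h v - h' v) = lin t h - lin t h'.
Proof. by rewrite /lin -sumrB; apply: eq_bigr => e _; rewrite scalerBr. Qed.

Lemma lin_map (M' : lmodType R) (f : {linear M -> M'}) t h :
  lin t (f \o h) = f (lin t h).
Proof. by rewrite /lin linear_sum; apply: eq_bigr => e _; rewrite linearZ. Qed.

Lemma lin_rename (W : Type) (g : V -> W) (k : W -> M) t :
  lin [seq (e.1, g e.2) | e <- t] k = lin t (k \o g).
Proof. by rewrite /lin big_map. Qed.
End Lin.

Lemma eq_lin (R : nzRingType) (V : eqType) (M : lmodType R) (t : seq (R * V))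
    (h h' : V -> M) :
  (forall e, e \in t -> h e.2 = h' e.2) -> lin t h = lin t h'.
Proof. by move=> hh; apply: eq_big_seq => e /hh ->. Qed.

(** A positive-primitive formula in one variable: variable [0] is free, the
    others are existentially quantified.  Sequences instead of matrices are used
    because over a countable ring the formulas then visibly form a countable
    type. *)
Definition pp1 (R : nzRingType) (E : seq (seq (R * nat))) (M : lmodType R) :
    set M :=
  [set x | exists2 h : nat -> M, h 0%N = x & forall t, t \in E -> lin t h = 0].

Lemma pp1_map (R : nzRingType) (M M' : lmodType R) (f : {linear M -> M'}) E x :
  pp1 E x -> pp1 E (f x).
Proof.
by move=> [h <- hE]; exists (f \o h) => // t /hE e; rewrite lin_map e linear0.
Qed.

Lemma pp1_0 (R : nzRingType) (M : lmodType R) E : pp1 E (0 : M).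
Proof. by exists (fun=> 0) => // t _; rewrite lin0. Qed.

Lemma pp1D (R : nzRingType) (M : lmodType R) E (x y : M) :
  pp1 E x -> pp1 E y -> pp1 E (x + y).
Proof.
move=> [h <- hE] [k <- kE]; exists (fun v => h v + k v) => // t tE.
by rewrite linD hE // kE // addr0.
Qed.

Lemma pp1B (R : nzRingType) (M : lmodType R) E (x y : M) :
  pp1 E x -> pp1 E y -> pp1 E (x - y).
Proof.
move=> [h <- hE] [k <- kE]; exists (fun v => h v - k v) => // t tE.
by rewrite linB hE // kE // subr0.
Qed.

(** The descending chain condition on pp-definable subgroups, stated for the
    chain of intersections of the initial segments of an arbitrary sequence of
    subgroups, so that a sequence of formulas need not be decreasing in the
    module at hand. *)
Definition pp_dcc (R : nzRingType) (M : lmodType R) : Prop :=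
  forall E : nat -> seq (seq (R * nat)), exists n : nat, forall x : M,
    (forall m, (m <= n)%N -> pp1 (E m) x) -> pp1 (E n.+1) x.

Section AlgebraicCompactness.
Variables (R : nzRingType) (M : lmodType R) (V : eqType).

(* The pair [(t, m)] stands for the equation [t = m]. *)
Local Notation eqn := (seq (R * V) * M)%type.

Definition solves (L : seq eqn) (h : V -> M) : Prop :=
  forall e, e \in L -> lin e.1 h = e.2.

Definition homsolves (L : seq eqn) (h : V -> M) : Prop :=
  forall e, e \in L -> lin e.1 h = 0.

Definition finitely_solvable (G : set eqn) : Prop :=
  forall L : seq eqn, (forall e, e \in L -> G e) -> exists h, solves L h.

Lemma solves_cat L L' h : solves (L ++ L') h <-> solves L h /\ solves L' h.
Proof.
split=> [s|[s s'] e]; last by rewrite mem_cat => /orP[/s|/s'].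
by split=> e eL; apply: s; rewrite mem_cat eL ?orbT.
Qed.

(** Only finitely many elements of [V] occur in [L], so they can be numbered,
    [c] receiving the number [0] of the free variable. *)
Lemma homsolves_pp1 (L : seq eqn) (c : V) :
  exists E, forall x : M, pp1 E x <-> exists2 h, homsolves L h & h c = x.
Proof.
pose s := c :: flatten [seq [seq e.2 | e <- l.1] | l <- L].
exists [seq [seq (e.1, index e.2 s) | e <- l.1] | l <- L] => x; split.
  move=> [h <- hE]; exists (fun v => h (index v s)); last by rewrite /= eqxx.
  move=> l lL; rewrite -[LHS](lin_rename (index^~ s)); apply: hE.
  by apply/mapP; exists l.
move=> [h hL <-]; exists (fun k => h (nth c s k)) => // _ /mapP[l lL ->].
rewrite (lin_rename (index^~ s)) -(hL _ lL); apply: eq_lin => e el /=.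
rewrite -[LHS]/(h (nth c s (index e.2 s))) nth_index //.
rewrite inE; apply/orP; right; apply/flattenP.
by exists [seq e.2 | e <- l.1]; apply/mapP; [exists l | exists e].
Qed.

(** If no finite part [L0] of [G] were minimal, a strictly increasing sequence
    of finite parts would give a strictly descending chain of pp-definable
    subgroups. *)
Lemma homsolves_min (G : set eqn) (c : V) : pp_dcc M ->
  exists2 L0 : seq eqn, forall e, e \in L0 -> G e &
    forall L, (forall e, e \in L -> G e) ->
    forall h, homsolves L0 h -> exists2 h', homsolves (L0 ++ L) h' & h' c = h c.
Proof.
move=> dccM; apply: contrapT => nomin.
pose T := {L : seq eqn | forall e, e \in L -> G e}.
pose step (L L' : T) := exists h, [/\ homsolves (sval L) h,
  (forall e, e \in sval L -> e \in sval L') &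
  forall h', homsolves (sval L') h' -> h' c <> h c].
have next (L : T) : {L' : T | step L L'}.
  apply: cid; apply: contrapT => noL; apply: nomin.
  exists (sval L) => [|L' L'G h hL]; first exact: (svalP L).
  apply: contrapT => noh; apply: noL.
  have LG e : e \in sval L ++ L' -> G e.
    by rewrite mem_cat => /orP[/(svalP L)|/L'G].
  exists (exist _ (sval L ++ L') LG), h; split=> //= [e eL|h' h'L hc].
    by rewrite mem_cat eL.
  by apply: noh; exists h'.
have T0 : T by exists [::].
have [Ls [_ LsP]] := dependent_choice next T0.
have sub m n : (m <= n)%N -> forall e, e \in sval (Ls m) -> e \in sval (Ls n).
  elim: n => [|n IHn]; first by rewrite leqn0 => /eqP->.
  rewrite leq_eqVlt ltnS => /predU1P[->//|/IHn s] e /s.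
  by have [h [_ + _]] := LsP n; exact.
have [E EP] := choice (fun n => homsolves_pp1 (sval (Ls n)) c).
have [n nP] := dccM E; have [h [hn _ hS]] := LsP n.
have /EP[h' h'S h'c] : pp1 (E n.+1) (h c).
  by apply: nP => m mn; apply/EP; exists h => // e /(sub _ _ mn)/hn.
exact: hS h'S h'c.
Qed.

(** The values that [c] takes in the solutions of a finite part [L] of [G] form
    a coset of a pp-definable subgroup.  By the chain condition one of these
    cosets is contained in all others, and any of its elements can be
    prescribed as the value of [c]. *)
Lemma finitely_solvable_assign (G : set eqn) (c : V) :
  pp_dcc M -> finitely_solvable G ->
  exists d : M, finitely_solvable (G `|` [set ([:: (1, c)], d)]).
Proof.
move=> dccM Gfs; have [L0 L0G L0min] := homsolves_min G c dccM.
have [h0 h0L] := Gfs _ L0G; exists (h0 c) => L LG.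
pose L' := [seq e <- L | `[< G e >]].
have L'G e : e \in L' -> G e by rewrite mem_filter => /andP[/asboolP].
have [e|h1 /solves_cat[h1L0 h1L']] := Gfs (L0 ++ L').
  by rewrite mem_cat => /orP[/L0G|/L'G].
(* By minimality of [L0], correcting [h1] to take the value of [h0] at [c]
   costs nothing on the equations of [L']. *)
have [e eL0|h2 h2L h2c] := L0min _ L'G (fun v => h0 v - h1 v).
  by rewrite linB h0L // h1L0 // subrr.
exists (fun v => h1 v + h2 v) => e eL; case: (LG e eL) => [Ge|->].
  have eL' : e \in L' by rewrite mem_filter eL andbT; apply/asboolP.
  by rewrite linD h1L' // h2L ?addr0 // mem_cat eL' orbT.
by rewrite /lin big_seq1 scale1r /= h2c addrC subrK.
Qed.

(** Values can be prescribed one variable at a time, so a maximal finitely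
    solvable extension of [G] prescribes the value of every variable.  As each
    equation has finitely many variables, these values solve it. *)
Theorem pp_dcc_algebraically_compact (G : set eqn) :
  pp_dcc M -> finitely_solvable G ->
  exists h : V -> M, forall e, G e -> lin e.1 h = e.2.
Proof.
move=> dccM Gfs.
have [F FP Ftot|X [Xfs Xmax]] :=
    @Zorn_bigcup _ [set X | finitely_solvable (G `|` X)].
  move=> L LGF; have [X [X0 LX]] : exists X, (X = set0 \/ F X) /\
      forall e, e \in L -> (G `|` X) e.
    elim: L LGF => [|e L IHL] LGF; first by exists set0; split=> //; left.
    have [e' e'L|X [XF LX]] := IHL; first by apply: LGF; rewrite inE e'L orbT.
    have [Ge|[Y FY Ye]] := LGF e (mem_head _ _).
      by exists X; split=> // e'; rewrite inE => /predU1P[->|/LX//]; left.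
    have [XY|YX] : X `<=` Y \/ Y `<=` X.
        by case: XF => [->|FX]; [left; exact: sub0set | exact: Ftot].
      exists Y; split; first by right.
      move=> e'; rewrite inE => /predU1P[->|/LX]; first by right.
      by case=> [|/XY]; [left|right].
    exists X; split=> // e'; rewrite inE => /predU1P[->|/LX//].
    by right; exact: YX.
  have GXfs : finitely_solvable (G `|` X).
    by case: X0 => [->|/FP//]; rewrite setU0.
  exact: GXfs.
have val c : {d : M | X ([:: (1, c)], d)}.
  apply: cid; have [d] := finitely_solvable_assign c dccM Xfs.
  rewrite -setUA => dfs; exists d; apply: contrapT => nXd.
  apply: (Xmax (X `|` [set ([:: (1, c)], d)])) => //; split; last first.
    by move=> sub; apply: nXd; apply: sub; right.
  by move=> e Xe; left.
exists (fun c => sval (val c)) => e Ge.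
have [e'|h hL] := Xfs (e :: [seq ([:: (1, v.2)], sval (val v.2)) | v <- e.1]).
  rewrite inE => /predU1P[->|/mapP[v _ ->]]; first by left.
  by right; exact: (svalP (val v.2)).
rewrite -(hL e (mem_head _ _)); apply: eq_lin => v ve.
have := hL ([:: (1, v.2)], sval (val v.2)).
rewrite /lin big_seq1 scale1r /= => -> //.
by rewrite inE; apply/orP; right; apply/mapP; exists v.
Qed.
End AlgebraicCompactness.

(** * Pure-injectivity and direct powers *)

(** When [s] does not contain the variable [v], [index v s] is out of range and
    [v] takes the value [0]. *)
Lemma lin_matrix (R : nzRingType) (V : eqType) (M : lmodType R) (s : seq V)
    (t : seq (R * V)) (k : 'I_(size s) -> M) :
  \sum_(j < size s) (\sum_(e <- t | index e.2 s == j) e.1) *: k j =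
  lin t (fun v => oapp k 0 (insub (index v s))).
Proof.
under eq_bigr do rewrite scaler_suml.
rewrite (exchange_big_dep predT) //=; apply: eq_bigr => e _ /=.
case: insubP => [j _ /= <-|jn] /=.
  by rewrite (big_pred1 (j : 'I_(size s))) //= => i; rewrite -val_eqE /= eq_sym.
rewrite scaler0 big_pred0 // => j; apply: contraNF jn => /eqP ->.
exact: ltn_ord.
Qed.

(** A retraction of a pure embedding [f : M -> N] is a solution in [M] of the
    system with a variable for each element of [N] whose equations are all
    those that the elements of [N] satisfy, the constants of [M] being read in
    [N] through [f].  Purity makes this system finitely solvable. *)
Theorem pp_dcc_pure_injective (R : nzRingType) (M : lmodType R) :
  pp_dcc M -> pure_injective M.
Proof.
move=> dccM N f [finj fpure].
pose G := [set e : seq (R * N) * M | lin e.1 id = f e.2].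
have [L LG|g gG] := pp_dcc_algebraically_compact dccM (_ : finitely_solvable G).
  pose s := flatten [seq [seq e.2 | e <- l.1] | l <- L].
  pose phi := @PPFormula R (size L) (size L) (size s) (- 1%:M)
    (\matrix_(i, j) \sum_(e <- (tnth (in_tuple L) i).1 | index e.2 s == j) e.1).
  (* The constants of the system are the free variables of [phi]. *)
  have phiE (M' : lmodType R) (u : 'I_(size L) -> M') v i :
      \sum_j pp_free phi i j *: u j + \sum_j pp_bound phi i j *: v j =
      - u i + lin (tnth (in_tuple L) i).1
                (fun n => oapp v 0 (insub (index n s))).
    rewrite -lin_matrix; congr (_ + _); last first.
      by apply: eq_bigr => j _; rewrite mxE.
    rewrite (bigD1 i) //= !mxE eqxx scaleN1r big1 ?addr0 // => j ji.
    by rewrite !mxE eq_sym (negPf ji) mulr0n oppr0 scale0r.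
  have [|v vE] := fpure _ phi (fun i => (tnth (in_tuple L) i).2).
    exists (tnth (in_tuple s)) => i; rewrite phiE /=.
    have iL := mem_tnth i (in_tuple L).
    rewrite -(LG _ iL) -[RHS](addNr (lin (tnth (in_tuple L) i).1 id)).
    congr (_ + _); apply: eq_lin => e ei.
    have es : e.2 \in s.
      apply/flattenP; exists [seq e.2 | e <- (tnth (in_tuple L) i).1].
        by apply/mapP; exists (tnth (in_tuple L) i).
      by apply/mapP; exists e.
    rewrite insubT /= ?index_mem // => lt.
    by rewrite (tnth_nth 0) /= nth_index.
  exists (fun n => oapp v 0 (insub (index n s))) => l lL.
  have /tnthP[i ->] : l \in in_tuple L by [].
  by have := vE i; rewrite phiE addrC => /subr0_eq.
have glin : linear g.
  move=> c x y.
  have := gG ([:: (c, x); (1, y); (-1, c *: x + y)], 0).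
  rewrite /G /= linear0 /lin !big_cons !big_nil /= !scale1r !scaleN1r !addr0.
  rewrite addrA subrr addrA => /(_ erefl) /subr0_eq ->.
  by [].
pose gl := GRing.isLinear.Build R N M *:%R g glin.
pose g' : {linear N -> M} := HB.pack g gl.
exists g' => m /=.
have := gG ([:: (1, f m)], m).
by rewrite /G /= /lin !big_seq1 !scale1r; exact.
Qed.

Definition dpower_coord (J : Type) (R : nzRingType) (M : lmodType R) (j : J)
    (x : dpower J M) : M := val x j.

Lemma dpower_coord_linear (J : Type) (R : nzRingType) (M : lmodType R) (j : J) :
  linear (@dpower_coord J R M j).
Proof. by move=> c x y; rewrite /dpower_coord linearP. Qed.

HB.instance Definition _ (J : Type) (R : nzRingType) (M : lmodType R) (j : J) :=
  GRing.isLinear.Build R (dpower J M) M *:%R (@dpower_coord J R M j)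
    (@dpower_coord_linear J R M j).

(** Solutions of a system in a direct power are the finitely supported families
    of solutions in [M]; where [x] vanishes the zero solution is chosen, to keep
    the support finite. *)
Lemma pp1_dpower (J : Type) (R : nzRingType) (M : lmodType R) E
    (x : dpower J M) :
  pp1 E x <-> forall j, pp1 E (dpower_coord j x).
Proof.
split=> [xE j|xE]; first exact: pp1_map.
have /choice[h hP] j : exists h : nat -> M,
    [/\ h 0%N = dpower_coord j x, forall t, t \in E -> lin t h = 0 &
        dpower_coord j x = 0 -> forall k, h k = 0].
  have [x0|/eqP xn0] := eqVneq (dpower_coord j x) 0.
    by exists (fun=> 0); split=> // t _; rewrite lin0.
  by have [h h0 hE] := xE j; exists h; split=> // /xn0.
have hfin k : (fun j => h j k) \in @dpower_pred J R M.
  apply/asboolP; have /asboolP xfin := valP x.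
  apply: sub_finite_set xfin => j /=; apply: contra_neq => xj0.
  by have [_ _ ->] := hP j.
have Sinj (y z : dpower J M) :
    (forall j, dpower_coord j y = dpower_coord j z) -> y = z.
  by move=> yz; apply/val_inj/funext.
exists (fun k => exist _ (fun j => h j k) (hfin k) : dpower J M).
  by apply: Sinj => j; have [] := hP j.
move=> t tE; apply: Sinj => j; rewrite -lin_map linear0.
by have [_ + _] := hP j; exact.
Qed.

Lemma pp_dcc_dpower (J : Type) (R : nzRingType) (M : lmodType R) :
  pp_dcc M -> pp_dcc (dpower J M).
Proof.
move=> dccM E; have [n nP] := dccM E; exists n => x xE.
by apply/pp1_dpower => j; apply: nP => m /xE /pp1_dpower.
Qed.

(** * Convergence in Polish modules *)

Section TopologicalModules.
Variables (R : nzRingType) (A : topModType R).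

Lemma topmodD_cvg (T : Type) (F : set_system T) (f g : T -> A) (a b : A) :
  Filter F -> f @ F --> a -> g @ F --> b -> f x + g x @[x --> F] --> a + b.
Proof.
move=> FF fa gb.
apply: (@continuous2_cvg _ _ _ _ F FF f g (fun x y : A => x + y) a b _ fa gb).
exact: (@topmod_add_continuous R A (a, b)).
Qed.

Lemma topmodB_cvg (T : Type) (F : set_system T) (f g : T -> A) (a b : A) :
  Filter F -> f @ F --> a -> g @ F --> b -> f x - g x @[x --> F] --> a - b.
Proof.
move=> FF fa gb; apply: topmodD_cvg => //.
apply: continuous_cvg gb; exact: topmod_opp_continuous.
Qed.

Lemma topmodZ_cvg (T : Type) (F : set_system T) (r : R) (f : T -> A) (a : A) :
  Filter F -> f @ F --> a -> r *: f x @[x --> F] --> r *: a.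
Proof.
move=> FF fa.
apply: (@continuous2_cvg _ (discrete_topology R) _ _ F FF (fun=> r) f
  (fun x y => (x : R) *: y) r a _ _ fa); last exact: cvg_cst.
exact: (@topmod_scale_continuous R A (r, a)).
Qed.

Lemma lin_cvg (T : Type) (F : set_system T) (V : Type) (t : seq (R * V))
    (h : T -> V -> A) (k : V -> A) :
  Filter F -> (forall v, h x v @[x --> F] --> k v) ->
  lin t (h x) @[x --> F] --> lin t k.
Proof.
move=> FF hk; elim: t => [|e t IHt].
  rewrite /lin big_nil; under eq_fun do rewrite big_nil; exact: cvg_cst.
rewrite /lin big_cons; under eq_fun do rewrite big_cons.
by apply: topmodD_cvg => //; exact: topmodZ_cvg.
Qed.

(** Countably many translates of any neighbourhood of [0] cover a separable
    module, and one of them must contain uncountably many members of an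
    uncountable family. *)
Lemma uncountable_near (T : Type) (S : set T) (g : T -> A) (W : set A) :
  separable A -> nbhs (0 : A) W -> ~ countable S ->
  exists2 S', S' `<=` S /\ ~ countable S' &
    forall i j, S' i -> S' j -> W (g i - g j).
Proof.
move=> [D Dc Dd] W0 Sunc.
have [[V1 V2] /= [V10 V20] VW] : nbhs (0 : A, 0 : A) (fun z => W (z.1 - z.2)).
  have /= := topmodB_cvg (F := nbhs (0 : A, 0 : A)) _ cvg_fst cvg_snd.
  by rewrite subr0; apply.
pose Se e := S `&` [set i | V1 (g i - e) /\ V2 (g i - e)].
have [e De Sec] : exists2 e, D e & ~ countable (Se e).
  apply: contrapT => noe; apply: Sunc.
  apply: (sub_countable (B := \bigcup_(e in D) Se e)); last first.
    apply: bigcup_countable => // e De; apply: contrapT => Sec.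
    by apply: noe; exists e.
  apply: subset_card_le => i Si.
  have : nbhs (g i) [set e | (V1 `&` V2) (g i - e)].
    have : g i - x @[x --> nbhs (g i)] --> g i - g i.
      by apply: topmodB_cvg; [exact: cvg_cst | exact: cvg_id].
    by rewrite subrr; apply; exact: filterI.
  rewrite nbhsE => -[O [Oopen Ogi] OV].
  have [|e [Oe De]] := Dd O _ Oopen; first by exists (g i).
  by exists e => //; split=> //; exact: OV.
exists (Se e); first by split=> // i [].
move=> i j [_ [V1i _]] [_ [_ V2j]].
by have := VW (g i - e, g j - e) (conj V1i V2j); rewrite /= opprB addrA subrK.
Qed.

Lemma uncountable_near_seq (T : Type) (J : eqType) (S : set T) (s : seq J)
    (g : J -> T -> A) (W : J -> set A) :
  separable A -> (forall j, nbhs (0 : A) (W j)) -> ~ countable S ->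
  exists2 S', S' `<=` S /\ ~ countable S' &
    forall j, j \in s -> forall x y, S' x -> S' y -> W j (g j x - g j y).
Proof.
move=> Asep W0 Sunc; elim: s => [|j s].
  by exists S => [|j]; [split | rewrite in_nil].
move=> [S1 [S1S S1unc] S1W].
have [S2 [S2S1 S2unc] S2W] := uncountable_near (g j) Asep (W0 j) S1unc.
exists S2; first by split=> // x /S2S1/S1S.
move=> j'; rewrite inE => /predU1P[->//|/S1W W' x y /S2S1 + /S2S1].
exact: W'.
Qed.
End TopologicalModules.

Section Metric.
Variables (K : realType) (T : topologicalType) (d : T -> T -> K).
Hypotheses (dm : is_metric d) (dT : metrizes d).

Lemma metrizes_ball (x : T) (e : K) : 0 < e -> nbhs x [set y | d x y < e].
Proof. by move=> e0; apply/dT; exists e. Qed.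

Lemma metrizes_cvg_unique (u : nat -> T) (x y : T) :
  u @ \oo --> x -> u @ \oo --> y -> x = y.
Proof.
case: dm => d0 dE dC dtri ux uy; apply/dE/eqP; rewrite eq_le d0 andbT.
apply/ler_addgt0Pl => e e0; rewrite addr0.
have e2 : 0 < e / 2 by rewrite divr_gt0.
have [z [/= zx zy]] := filter_ex (filterI (ux _ (metrizes_ball x e2))
  (uy _ (metrizes_ball y e2))).
by rewrite (le_trans (dtri _ z _)) // (splitr e) ltW // ltrD // dC.
Qed.

(** The metric of a completely metrizable module need not be invariant, hence
    the summability criterion bears on the distances of successive partial sums
    instead of the size of the terms. *)
Lemma geometric_steps_cvg (u : nat -> T) (k0 : nat) :
  complete_metric d ->
  (forall k, (k0 <= k)%N -> d (u k) (u k.+1) < 2^-1 ^+ k) ->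
  exists l : T, u @ \oo --> l.
Proof.
case: dm => d0 dE dC dtri dcompl ustep; apply: dcompl => e e0.
have tail m n : (k0 <= m)%N -> d (u m) (u (m + n)%N) <= 2 * 2^-1 ^+ m.
  move=> k0m; apply: (@le_trans _ _ (2 * 2^-1 ^+ m - 2 * 2^-1 ^+ (m + n))).
    elim: n => [|n IHn]; first by rewrite addn0 subrr (dE _ _).2.
    rewrite addnS (le_trans (dtri _ (u (m + n)%N) _)) //.
    have /ltW stepn := ustep _ (leq_trans k0m (leq_addr n m)).
    rewrite (le_trans (lerD IHn stepn)) // exprS.
    rewrite mulrA divff ?pnatr_eq0 // mul1r.
    by rewrite -addrA [2 * _ ^+ (m + n)]mulr_natl mulr2n opprD subrK.
  by rewrite gerBl mulr_ge0 // exprn_ge0 // invr_ge0.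
have [N Ne] : exists N, 2 * 2^-1 ^+ N < e.
  exists (Num.bound (2 / e)).
  rewrite exprVn ltr_pdivrMr ?exprn_gt0 // mulrC -ltr_pdivrMr //.
  exact: upper_nthrootP.
exists (maxn k0 N) => m n.
wlog mn : m n / (m <= n)%N => [wlg mN nN|].
  have [mn|/ltnW nm] := leqP m n; first exact: wlg.
  by rewrite dC; exact: wlg.
rewrite geq_max => /andP[m0 mN] _; apply: le_lt_trans Ne.
rewrite -(subnKC mn) (le_trans (tail _ _ m0)) // ler_pM2l //.
by apply: ler_wiXn2l => //; rewrite ?invr_ge0 // invf_le1 // ler1n.
Qed.
End Metric.

(** * Descending chains in a Polish module with many coordinates *)

Definition isolates (R : nzRingType) (A : lmodType R) (I : Type)
    (p : I -> {linear A -> A}) (i : I) (t : A) : Prop :=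
  p i t = t /\ forall j, j <> i -> p j t = 0.

Section Gaps.
Variables (K : realType) (R : nzRingType) (A : topModType R) (I : Type).
Variable p : I -> {linear A -> A}.
Hypotheses (Asep : separable A)
  (pfin : forall x, finite_set [set i | p i x != 0]).

Variable E : nat -> seq (seq (R * nat)).

Definition gap (n : nat) : set I := [set i | exists t,
  [/\ isolates p i t, forall m, (m <= n)%N -> pp1 (E m) t & ~ pp1 (E n.+1) t]].

(* [s m j] is the value of the [j]-th variable of the system [E m]. *)
Local Notation witness := (nat -> nat -> A).

Variable d : A -> A -> K.

(** One term of the series: [s] and [s'] are successive partial sums.  The
    system [E m] only takes part from stage [m] on, so [s m] accumulates
    witnesses for the terms of index at least [m].  Only the variables of index
    at most [k] are controlled at stage [k], which is enough for convergence in
    each of them. *)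
Record step (k : nat) (s s' : witness) : Prop := Step {
  step_sol : forall m t, (m <= k)%N -> t \in E m ->
    lin t (fun j => s' m j - s m j) = 0;
  step_free : forall m, (m <= k)%N ->
    s' m 0%N - s m 0%N = s' 0%N 0%N - s 0%N 0%N;
  step_late : forall m j, (k < m)%N -> s' m j = s m j;
  step_near : forall m j, (m <= k)%N -> (j <= k)%N ->
    d (s m j) (s' m j) < 2^-1 ^+ k;
  step_new : exists i, p i (s 0%N 0%N) = 0 /\
    ~ pp1 (E k.+1) (p i (s' 0%N 0%N - s 0%N 0%N)) }.

Hypotheses (dm : is_metric d) (dT : metrizes d) (dcompl : complete_metric d).

(** The new term is the difference of two close members of an uncountable family
    of witnesses of gaps, at indices outside the support of the partial sum
    [s 0 0]. *)
Lemma step_exists (k : nat) (s : witness) :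
  ~ countable (gap k) -> exists s', step k s s'.
Proof.
move=> gunc.
have /choice[tau tauP] (i : I) : exists tau : witness, gap k i ->
    [/\ isolates p i (tau 0%N 0%N),
        forall m t, (m <= k)%N -> t \in E m -> lin t (tau m) = 0,
        forall m, (m <= k)%N -> tau m 0%N = tau 0%N 0%N,
        forall m j, (k < m)%N -> tau m j = 0 &
        ~ pp1 (E k.+1) (tau 0%N 0%N)].
  have [[t [ti tE tnE]]|ngi] := pselect (gap k i); last first.
    by exists (fun _ _ => 0).
  have /choice[w wP] m : exists w : nat -> A, (m <= k)%N ->
      w 0%N = t /\ forall e, e \in E m -> lin e w = 0.
    case: (leqP m k) => [mk|_]; last by exists (fun=> 0).
    by have [w w0 wE] := tE m mk; exists w.
  have w0 m : (m <= k)%N -> w m 0%N = t by move=> /wP[].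
  exists (fun m j => if (m <= k)%N then w m j else 0) => _.
  rewrite !w0 //; split=> // [m e mk eE|m mk|m j km].
  - by rewrite mk; have [_ ->] := wP m mk.
  - by rewrite mk w0.
  - by rewrite leqNgt km.
pose S := gap k `\` [set i | p i (s 0%N 0%N) != 0].
have Sunc : ~ countable S.
  move=> Sc; apply: gunc.
  apply: (sub_countable
    (B := \bigcup_(b in [set: bool])
            if b then S else [set i | p i (s 0%N 0%N) != 0])); last first.
    apply: bigcup_countable => [|[] _ //]; first exact: countableP.
    exact/finite_set_countable/pfin.
  apply: subset_card_le => i gi.
  have [/eqP si|si] := boolP (p i (s 0%N 0%N) == 0); last by exists false.
  by exists true => //; split=> //=; rewrite si eqxx.
pose js := [seq (m, j) | m <- iota 0 k.+1, j <- iota 0 k.+1].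
pose W (mj : nat * nat) :=
  [set y | d (s mj.1 mj.2) (s mj.1 mj.2 + y) < 2^-1 ^+ k].
have W0 mj : nbhs (0 : A) (W mj).
  have : s mj.1 mj.2 + y @[y --> (0 : A)] --> s mj.1 mj.2 + 0.
    by apply: topmodD_cvg; [exact: cvg_cst | exact: cvg_id].
  rewrite addr0 => /(_ _ (metrizes_ball dT _ _)); apply.
  by rewrite exprn_gt0 // invr_gt0.
have [S' [S'S S'unc] S'W] := uncountable_near_seq js
  (fun mj i => tau i mj.1 mj.2) Asep W0 Sunc.
have [i [i' [Si Si' ii']]] : exists i i', [/\ S' i, S' i' & i' <> i].
  apply: contrapT => noii; apply: S'unc.
  have [[i Si]|S'0] := pselect (exists i, S' i).
    apply: (sub_countable _ (countable1 i)); apply: subset_card_le => i' Si'.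
    by apply: contrapT => ii'; apply: noii; exists i, i'.
  rewrite (_ : S' = set0); first exact: countable0.
  by apply/seteqP; split=> // i Si; apply: S'0; exists i.
have [/tauP[[ti _] solt freet latet tnE] /negP/negPn/eqP si] := S'S _ Si.
have [/tauP[[_ ti'] solt' freet' latet' _] _] := S'S _ Si'.
have diff m j : s m j + (tau i m j - tau i' m j) - s m j =
    tau i m j - tau i' m j by rewrite addrC addKr.
exists (fun m j => s m j + (tau i m j - tau i' m j)); split.
- move=> m t mk tE.
  rewrite (eq_lin (h' := fun j => tau i m j - tau i' m j)) => [|e _].
    by rewrite linB solt // solt' // subrr.
  exact: diff.
- by move=> m mk; rewrite !diff freet // freet'.
- by move=> m j km; rewrite latet // latet' // subrr addr0.
- move=> m j mk jk; apply: (S'W (m, j)) => //.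
  by apply/allpairsP; exists (m, j); rewrite !mem_iota.
- exists i; split=> //; rewrite diff linearB ti ti' ?subr0 //.
  by move=> e; apply: ii'.
Qed.

(** The limit of the partial sums would have a nonzero coordinate at each of the
    infinitely many indices provided by the steps. *)
Lemma steps_limit (s : nat -> witness) :
  s 0%N = (fun _ _ => 0) -> (forall k, step k (s k) (s k.+1)) -> False.
Proof.
move=> s0 sP.
have late k m j : (k <= m)%N -> s k m j = 0.
  elim: k => [|k IHk] km; first by rewrite s0.
  by rewrite (step_late (sP k)) // IHk // ltnW.
have sol k m t : t \in E m -> lin t (s k m) = 0.
  move=> tE; elim: k => [|k IHk].
    by rewrite s0 -[RHS](lin0 _ t).
  have [mk|km] := leqP m k.
    by have := step_sol (sP k) mk tE; rewrite linB IHk subr0.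
  rewrite -[RHS](lin0 A t); apply: eq_lin => e _; exact: late.
have free k m : (m <= k)%N -> s k m 0%N = s k 0%N 0%N - s m 0%N 0%N.
  elim: k => [|k IHk].
    by rewrite leqn0 => /eqP->; rewrite late // subrr.
  rewrite leq_eqVlt => /predU1P[->|]; first by rewrite late // subrr.
  rewrite ltnS => mk; have := step_free (sP k) mk.
  by rewrite IHk // => /(canRL (subrK _)) ->; rewrite addrA subrK.
have /choice[w wP] (m : nat) : exists w : nat -> A, forall j,
    s k m j @[k --> \oo] --> w j.
  suff /choice[w wP] j : exists l : A, s k m j @[k --> \oo] --> l by exists w.
  apply: (geometric_steps_cvg (k0 := maxn m j) dm) => // k.
  by rewrite geq_max => /andP[mk jk]; exact: (step_near (sP k)).
have wsol m : pp1 (E m) (w 0%N 0%N - s m 0%N 0%N).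
  exists (w m).
    apply: (metrizes_cvg_unique dm dT (wP m 0%N)).
    apply: (@cvg_trans _ (s k 0%N 0%N - s m 0%N 0%N @[k --> \oo])).
      apply: near_eq_cvg; near=> k; rewrite (free k m) //.
      by near: k; exact: nbhs_infty_ge.
    by apply: topmodB_cvg; [exact: wP | exact: cvg_cst].
  move=> t tE; apply: (metrizes_cvg_unique dm dT (u := fun k => lin t (s k m))).
    by apply: lin_cvg => j; exact: wP.
  by under eq_fun do rewrite sol //; exact: cvg_cst.
have ssol k m : (m <= k)%N -> pp1 (E m) (s k 0%N 0%N - s m 0%N 0%N).
  by move=> mk; rewrite -free //; exists (s k m) => // t; exact: sol.
have [i iP] := choice (fun k => step_new (sP k)).
(* The coordinate at [i k] of the partial sum of stage [k.+1] is not in the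
   subgroup of [E k.+1], so it cannot vanish modulo this subgroup. *)
have inz k x : pp1 (E k.+1) (x - s k.+1 0%N 0%N) -> p (i k) x != 0.
  have [ik0 ikn] := iP k.
  move=> xk; apply/eqP => pix; apply: ikn.
  rewrite linearB ik0 subr0 -[p _ _]opprK -[- p _ _]add0r -pix -linearB.
  by rewrite -[- _]add0r; apply: pp1B; [exact: pp1_0 | exact: pp1_map].
have iinj : injective i.
  suff ilt : forall m n, (m < n)%N -> i m <> i n.
    move=> m n imn; have [mn|nm|//] := ltngtP m n.
      by have := ilt m n mn imn.
    by have := ilt n m nm (esym imn).
  move=> m n mn imn; have := inz m (s n 0%N 0%N) (ssol _ _ mn).
  by rewrite imn; have [-> _] := iP n; rewrite eqxx.
apply: infinite_nat.
rewrite [X in finite_set X](_ : _ = i @^-1` [set j | p j (w 0%N 0%N) != 0]).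
  by apply: finite_preimage (pfin _) => m n _ _; exact: iinj.
by apply/seteqP; split=> k //= _; exact/inz/wsol.
Unshelve. all: by end_near.
Qed.

Lemma gap_countable : exists n, countable (gap n).
Proof.
apply: contrapT => nc.
have /choice[next nextP] (ks : nat * witness) : exists s', step ks.1 ks.2 s'.
  by apply: step_exists => c; apply: nc; exists ks.1.
pose s := fix s k := if k is k'.+1 then next (k', s k') else fun _ _ => 0.
by apply: (@steps_limit s) => // k; exact: (nextP (k, s k)).
Qed.
End Gaps.

(** * Direct decompositions *)

Section Decomposition.
Variables (R : nzRingType) (A : lmodType R) (I : choiceType).
Variable A_ : I -> submodClosed A.

Record coordinates (p : I -> {linear A -> A}) : Prop := Coordinates {
  coord_mem : forall i x, p i x \in A_ i;
  coord_finite : forall x, finitely_supported (p^~ x);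
  coord_sum : forall x, x = \sum_(i \in [set: I]) p i x;
  coord_unique : forall (a : I -> A) x, (forall i, a i \in A_ i) ->
    finitely_supported a -> x = \sum_(i \in [set: I]) a i ->
    forall i, p i x = a i }.

Lemma direct_coordinates : direct_decomposition A_ -> exists p, coordinates p.
Proof.
move=> dec; have [c cP] := choice dec.
have clin i : linear (c^~ i).
  move=> k x y; have [[cx fx sx] _] := cP x; have [[cy fy sy] _] := cP y.
  have [_ /(_ (fun i => k *: c x i + c y i)) ->//] := cP (k *: x + y); split.
  - by move=> j; rewrite rpredD // rpredZ.
  - exact: finitely_supportedP.
  - by rewrite finitely_supported_sumP // -sx -sy.
pose p i : {linear A -> A} :=
  HB.pack (c^~ i) (GRing.isLinear.Build R A A *:%R (c^~ i) (clin i)).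
exists p; split=> [i x|x|x|a x aA fa xa i].
- by have [[cx _ _] _] := cP x; exact: cx.
- by have [[_ fx _] _] := cP x.
- by have [[_ _ sx] _] := cP x.
- by have [_ /(_ a) e] := cP x; rewrite /= e.
Qed.

Variables (p : I -> {linear A -> A}) (pP : coordinates p).

Lemma coord_inj x y : (forall i, p i x = p i y) -> x = y.
Proof.
move=> xy; rewrite (coord_sum pP x) (coord_sum pP y).
by apply: eq_fsbigr => i _; exact: xy.
Qed.

Lemma coord_summand i t : t \in A_ i -> isolates p i t.
Proof.
move=> ti; have pt j : p j t = if j == i then t else 0.
  apply: (coord_unique pP (a := fun j => if j == i then t else 0)).
  - by move=> k; case: eqP => [->|_] //; exact: rpred0.
  - apply: (sub_finite_set (B := [set i])) => //.
    by move=> k /=; case: (k =P i) => // _; rewrite eqxx.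
  - rewrite -(fsbig_widen [set i] setT) // => [|k [_ ki] /=]; last by case: eqP.
    by rewrite fsbig_set1 eqxx.
by split=> [|j /eqP/negPf ji]; rewrite pt ?eqxx ?ji.
Qed.

Lemma coord_partial_sum (D : set I) (a : I -> A) :
  (forall i, a i \in A_ i) -> finitely_supported a ->
  forall i, p i (\sum_(j \in D) a j) = if i \in D then a i else 0.
Proof.
move=> aA fa; apply: (coord_unique pP).
- by move=> i; case: ifP => // _; exact: rpred0.
- by apply: sub_finite_set fa => i /=; case: ifP => //; rewrite eqxx.
- by rewrite fsbig_mkcond.
Qed.

Lemma partial_sumP (D : set I) x :
  x \in partial_sum A_ D <-> forall i, ~ D i -> p i x = 0.
Proof.
split=> [/asboolP[a [aA fa ->]] i Di|xD].
  by rewrite coord_partial_sum // memNset.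
apply/asboolP; exists (p^~ x); split.
- by move=> i; exact: coord_mem.
- exact: coord_finite.
- rewrite {1}(coord_sum pP x); apply/esym/fsbig_widen => // i [_ /xD].
  by [].
Qed.

Definition partial_proj (D : set I) (x : A) : A := \sum_(i \in D) p i x.

Lemma coord_partial_proj D x i :
  p i (partial_proj D x) = if i \in D then p i x else 0.
Proof.
by rewrite coord_partial_sum // => *; [exact: coord_mem | exact: coord_finite].
Qed.

Lemma partial_proj_mem D x : partial_proj D x \in partial_sum A_ D.
Proof. by apply/partial_sumP => i Di; rewrite coord_partial_proj memNset. Qed.

Lemma partial_proj_linear D : linear (partial_proj D).
Proof.
move=> k x y; rewrite -finitely_supported_sumP; try exact: coord_finite.
by apply: eq_fsbigr => i _; rewrite linearP.
Qed.

Lemma partial_proj_id D x : x \in partial_sum A_ D -> partial_proj D x = x.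
Proof.
move=> /partial_sumP xD; apply: coord_inj => i.
rewrite coord_partial_proj; case: ifPn => // /negP iD.
by rewrite xD // => /mem_set.
Qed.

Lemma partial_sum_split (D D' : set I) :
  D `|` D' = [set: I] -> D `&` D' = set0 ->
  forall x : A, exists! z : A * A,
    [/\ z.1 \in partial_sum A_ D, z.2 \in partial_sum A_ D' & x = z.1 + z.2].
Proof.
move=> DU DI x.
have cover i : D i \/ D' i by have : [set: I] i by []; rewrite -DU.
have disj i : D i -> D' i -> False.
  by move=> Di D'i; have : set0 i by rewrite -DI.
exists (partial_proj D x, partial_proj D' x); split=> /=.
  split; try exact: partial_proj_mem.
  apply: coord_inj => i; rewrite linearD /= !coord_partial_proj.
  have [Di|D'i] := cover i.
    by rewrite mem_set // memNset ?addr0 // => /(disj _ Di).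
  by rewrite [i \in D']mem_set // memNset ?add0r // => /disj; exact.
move=> [b u] /= [/partial_sumP bD /partial_sumP uD' ->].
congr pair; apply: coord_inj => i; rewrite coord_partial_proj linearD /=.
  case: ifPn => [/set_mem Di|/negP iD].
    by rewrite uD' ?addr0 // => /(disj _ Di).
  by rewrite bD // => /mem_set.
case: ifPn => [/set_mem Di|/negP iD]; last by rewrite uD' // => /mem_set.
by rewrite bD ?add0r // => /disj; exact.
Qed.

(** The projection onto the partial sum along the other summands carries a
    solution in [A] to a solution in the partial sum, and fixes [x]. *)
Lemma pp1_partial_sum (D : set I) E (x : submod_type (partial_sum A_ D)) :
  pp1 E x <-> pp1 E (val x).
Proof.
split=> [xE|xE]; first exact: pp1_map.
pose r (y : A) : submod_type (partial_sum A_ D) :=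
  exist _ (partial_proj D y) (partial_proj_mem D y).
have rlin : linear r.
  by move=> k y z; apply: val_inj; exact: partial_proj_linear.
pose r' : {linear A -> submod_type (partial_sum A_ D)} :=
  HB.pack r (GRing.isLinear.Build R _ _ *:%R r rlin).
suff <- : r' (val x) = x by exact: pp1_map.
by apply: val_inj; exact: partial_proj_id (valP x).
Qed.

Lemma pp1_coord E x : (forall i, pp1 E (p i x)) -> pp1 E x.
Proof.
move=> xE; rewrite (coord_sum pP x).
by apply: big_ind => [|y z|i _]; [exact: pp1_0 | exact: pp1D |].
Qed.

(** Elements of the sum are sums of finite sequences of elements of the union
    of the summands, which is countable. *)
Lemma partial_sum_countable (D : set I) :
  countable D -> (forall i, countable [set x : A | x \in A_ i]) ->
  countable [set x : A | x \in partial_sum A_ D].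
Proof.
move=> Dc Ac; pose C := \bigcup_(i in D) [set x : A | x \in A_ i].
have /countable_injP[f finj] : countable C by apply: bigcup_countable.
pose L := [set s : seq A | forall y, y \in s -> C y].
have Lc : countable L.
  apply/countable_injP; exists (fun s => choice.pickle [seq f y | y <- s]).
  move=> s s' /set_mem + /set_mem + /(pcan_inj choice.pickleK).
  elim: s s' => [|y s IHs] [|y' s'] //= sL s'L [fy fs]; congr cons.
    apply: finj => //; apply: mem_set; [apply: sL | apply: s'L];
      exact: mem_head.
  by apply: IHs => // z zs; [apply: sL | apply: s'L]; rewrite inE zs orbT.
apply: (sub_countable (B := (fun s : seq A => \sum_(y <- s) y) @` L)).
  apply: subset_card_le => x /asboolP[a [aA fa ->]].
  have fD : finite_set (D `&` [set i | a i != 0]) by exact: finite_setIr.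
  exists [seq a i | i <- fset_set (D `&` [set i | a i != 0])].
    move=> _ /mapP[i + ->]; rewrite in_fset_set // => /set_mem[Di _].
    by exists i => //=; exact: aA.
  rewrite big_map -fsbig_finite //; apply: fsbig_widen => [i []//|i [Di ni]].
  by apply/eqP/negPn/negP => ai; apply: ni.
exact: sub_countable (card_image_le _ _) Lc.
Qed.
End Decomposition.

Lemma countable_systems (R : nzRingType) : countable [set: R] ->
  countable [set: seq (seq (seq (R * nat))) * seq (seq (R * nat))].
Proof.
move=> /countable_injP[f finj].
have fi : injective f by move=> r r'; apply: finj; rewrite in_setT.
pose g := map (map (fun e : R * nat => (f e.1, e.2))).
have gi : injective g.
  by apply/inj_map/inj_map => -[r n] [r' n'] [/fi -> ->].
apply/countable_injP; exists (fun q => choice.pickle (map g q.1, g q.2)).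
move=> [Phi psi] [Phi' psi'] _ _ /(pcan_inj choice.pickleK).
by move=> [/(inj_map gi) -> /gi ->].
Qed.

(** * The decomposition *)

Theorem theorem1p1 (K : realType) (R : nzRingType) (A : topModType R)
    (I : choiceType) (A_ : I -> submodClosed A) :
  countable [set: R] ->
  polish K A ->
  ~ countable [set: A] ->
  kaplansky_decomposition A_ ->
  exists I1 I2 : set I,
    [/\ I1 `|` I2 = [set: I], I1 `&` I2 = set0, countable I1 &
      let B := partial_sum A_ I1 in
      let U := partial_sum A_ I2 in
      [/\ forall x : A, exists! p : A * A,
            [/\ p.1 \in B, p.2 \in U & x = p.1 + p.2],
          ~ countable [set x : A | x \in U] &
          sigma_algebraically_compact (submod_type U)]].
Proof.
move=> Rc Apol Aunc [/direct_coordinates[p pP] Asmall].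
have Ac i : countable [set x : A | x \in A_ i] by have [] := Asmall i.
pose gaps (q : seq (seq (seq (R * nat))) * seq (seq (R * nat))) : set I :=
  [set i | exists t : A,
    [/\ t \in A_ i, forall E, E \in q.1 -> pp1 E t & ~ pp1 q.2 t]].
pose I1 := \bigcup_(q in [set q | countable (gaps q)]) gaps q.
have I1c : countable I1.
  apply: bigcup_countable => //.
  apply: sub_countable (countable_systems Rc).
  exact: subset_card_le.
have split := partial_sum_split pP (setUv I1) (setICr I1).
exists I1, (~` I1); split; [exact: setUv | exact: setICr | exact: I1c |].
split=> [x| Uc |J]; first exact: split.
  apply: Aunc; have Bc := partial_sum_countable I1c Ac.
  apply: (sub_countable (B := (fun z : A * A => z.1 + z.2) @`
    ([set x : A | x \in partial_sum A_ I1] `*`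
     [set x : A | x \in partial_sum A_ (~` I1)]))).
    apply: subset_card_le => x _; have [z [[zB zU ->] _]] := split x.
    by exists z.
  apply: sub_countable (card_image_le _ _) _.
  exact: countableX.
apply/pp_dcc_pure_injective/pp_dcc_dpower => E.
have [Asep [d [dm dT dcompl]]] := Apol.
have [n gapc] := gap_countable Asep (coord_finite pP) E dm dT dcompl.
exists n => x xE; apply/(pp1_partial_sum pP)/(pp1_coord pP) => i.
(* At an index outside [I1] the summand has no gap for the pair singled out by
   [n], since that pair contributes all its gaps to [I1]. *)
have [I1i|nI1i] := pselect (I1 i).
  by have /(partial_sumP pP) -> := valP x; [exact: pp1_0 | apply].
apply: contrapT => npi; apply: nI1i.
exists ([seq E m | m <- iota 0 n.+1], E n.+1).
  apply: sub_countable gapc; apply: subset_card_le => j [t [tj tE tnE]].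
  exists t; split=> // [|m mn]; first exact: coord_summand tj.
  by apply: tE; apply/mapP; exists m; rewrite ?mem_iota.
exists (p i (val x)); split=> //; first exact: coord_mem.
move=> _ /mapP[m + ->]; rewrite mem_iota ltnS => mn.
by apply/pp1_map/(pp1_partial_sum pP)/xE.
Qed.
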